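(* Let $\mathcal V$ be a symmetric monoidal closed category, let $\mathbb T=(T,\eta,\mu)$ be a $\mathcal V$-monad on a $\mathcal V$-category $\mathcal B$ equipped with a $\mathcal V$-proper $\mathcal V$-factorization-system $(\mathcal E,\mathcal M)$, and suppose that every morphism in $\mathcal B$ factors as a $\mathbb T$-dense morphism followed by a $\mathbb T$-closed $\mathcal M$-embedding. Then: (1) The idempotent $\mathcal V$-core $\widetilde{\mathbb T}$ of $\mathbb T$ exists. (2) The $\mathcal V$-reflective-subcategory of $\mathcal B$ determined by $\widetilde{\mathbb T}$ consists of the $\mathbb T$-complete objects. (3) Every $\mathbb T$-complete object of $\mathcal B$ is $\mathbb T$-separated. (4) Each component of the unique morphism of $\mathcal V$-monads $\iota:\widetilde{\mathbb T}\to\mathbb T$ is a $\mathbb T$-closed $\mathcal M$-embedding. (5) Each component of the unit $\rho:1_{\mathcal B}\to\widetilde T$ of $\widetilde{\mathbb T}$ is a $\mathbb T$-dense morphism. (6) Every $\mathcal V$-adjunction $F\dashv G:\mathcal C\to\mathcal B$ inducing $\mathbb T$ factors through the $\mathcal V$-reflection $K\dashv J:\mathcal B_{\Sigma_T}\hookrightarrow\mathcal B$ determined by $\widetilde{\mathbb T}$, in such a way that the induced left $\mathcal V$-adjoint $F':\mathcal B_{\Sigma_T}\to\mathcal C$ is conservative (i.e. reflects isomorphisms).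
   Context: No limits or colimits are assumed in $\mathcal V$. A morphism of a $\mathcal V$-category $\mathcal B$ means a morphism of its underlying ordinary category; ordinary notions applied to $\mathcal B$ refer to that category. Categories are not assumed locally small. A morphism $m:B_1\to B_2$ of $\mathcal B$ is a $\mathcal V$-mono if $\mathcal B(A,m)$ is a monomorphism in $\mathcal V$ for every $A\in\mathcal B$; a $\mathcal V$-epi is a $\mathcal V$-mono in $\mathcal B^{\mathrm{op}}$. For $e:A_1\to A_2$ and $m:B_1\to B_2$ in $\mathcal B$, write $e\downarrow_{\mathcal V}m$ if the commutative square with sides $\mathcal B(A_2,m),\ \mathcal B(e,B_1),\ \mathcal B(e,B_2),\ \mathcal B(A_1,m)$ exhibits $\mathcal B(A_2,B_1)$ as the pullback of $\mathcal B(A_1,B_1)\to\mathcal B(A_1,B_2)\leftarrow\mathcal B(A_2,B_2)$ in $\mathcal V$. For classes of morphisms, $\mathcal E^{\downarrow_{\mathcal V}}=\{m\mid \forall e\in\mathcal E: e\downarrow_{\mathcal V}m\}$ and $\mathcal M^{\uparrow_{\mathcal V}}=\{e\mid\forall m\in\mathcal M: e\downarrow_{\mathcal V}m\}$. $(\mathcal E,\mathcal M)$ is a $\mathcal V$-prefactorization-system if $\mathcal E^{\downarrow_{\mathcal V}}=\mathcal M$ and $\mathcal M^{\uparrow_{\mathcal V}}=\mathcal E$; it is a $\mathcal V$-factorization-system if moreover every morphism factors as a morphism in $\mathcal E$ followed by one in $\mathcal M$. It is $\mathcal V$-proper if every morphism in $\mathcal E$ is a $\mathcal V$-epi and every morphism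 in $\mathcal M$ is a $\mathcal V$-mono. Morphisms in $\mathcal M$ are called $\mathcal M$-embeddings. $\Sigma_T$ is the class of morphisms of $\mathcal B$ inverted by $T$ (sent to isomorphisms). An object $B$ is $\mathbb T$-complete if $\mathcal B(h,B):\mathcal B(A_2,B)\to\mathcal B(A_1,B)$ is an isomorphism in $\mathcal V$ for every $h:A_1\to A_2$ in $\Sigma_T$; $\mathcal B_{\Sigma_T}$ is the full sub-$\mathcal V$-category of $\mathbb T$-complete objects. $B$ is $\mathbb T$-separated if $\eta_B:B\to TB$ is an $\mathcal M$-embedding. An $\mathcal M$-embedding is $\mathbb T$-closed if it lies in $\Sigma_T^{\downarrow_{\mathcal V}}$. A morphism is $\mathbb T$-dense if it lies in $(\Sigma_T^{\downarrow_{\mathcal V}}\cap\mathcal M)^{\uparrow_{\mathcal V}}$. A $\mathcal V$-monad is idempotent if its multiplication is an isomorphism. A morphism of $\mathcal V$-monads on $\mathcal B$ is a $\mathcal V$-natural transformation of the underlying $\mathcal V$-endofunctors commuting with units and multiplications. An idempotent $\mathcal V$-core of $\mathbb T$ is an idempotent $\mathcal V$-monad $\widetilde{\mathbb T}$ on $\mathcal B$ whose underlying endofunctor $\widetilde T$ inverts the same morphisms as $T$ (it is unique up to isomorphism if it exists, and there is then a unique morphism of $\mathcal V$-monads $\widetilde{\mathbb T}\to\mathbb T$). A $\mathcal V$-reflective-subcategory of $\mathcal B$ is a full replete sub-$\mathcal V$-category whose inclusion $J$ has a left $\mathcal V$-adjoint $K$; the $\mathcal V$-adjunction $K\dashv J$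 is called a $\mathcal V$-reflection. An idempotent $\mathcal V$-monad with unit $\rho$ determines the $\mathcal V$-reflective-subcategory of those $B$ with $\rho_B$ an isomorphism (and the corresponding $\mathcal V$-reflection inducing it). A $\mathcal V$-adjunction $F\dashv G:\mathcal C\to\mathcal B$ factors through a $\mathcal V$-reflection $K\dashv J:\mathcal B'\hookrightarrow\mathcal B$ if $GC\in\mathcal B'$ for all $C\in\mathcal C$. In this case the corestriction $G':\mathcal C\to\mathcal B'$ of $G$ has left $\mathcal V$-adjoint $F'=FJ$ (with $F'K\cong F$), called the induced left $\mathcal V$-adjoint. *)

(* Defs.v *)
(* Hom types carry Leibniz equality, and classes of morphisms and full
   subcategories are given by [Prop]-valued predicates; objects and morphisms
   range over arbitrary types, so nothing is assumed small. *)
From mathcomp Require Import ssreflect ssrfun.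

Set Implicit Arguments.
Unset Strict Implicit.
Unset Printing Implicit Defensive.

Declare Scope cat_scope.
Delimit Scope cat_scope with cat.
Local Open Scope cat_scope.

Reserved Notation "g ∘ f" (at level 40, left associativity).
Reserved Notation "X ⊗ Y" (at level 35, right associativity).
Reserved Notation "f ⊗m g" (at level 35, right associativity).

Record category := Category {
  obj :> Type;
  hom : obj -> obj -> Type;
  idm : forall A, hom A A;
  comp : forall A B C, hom B C -> hom A B -> hom A C;
  compA : forall A B C D (h : hom C D) (g : hom B C) (f : hom A B),
    comp h (comp g f) = comp (comp h g) f;
  comp1m : forall A B (f : hom A B), comp (idm B) f = f;
  compm1 : forall A B (f : hom A B), comp f (idm A) = f
}.
Arguments hom {_} _ _.
Arguments idm {_} _.
Arguments comp {_ _ _ _} _ _.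

Notation "g ∘ f" := (comp g f) : cat_scope.

Section Ordinary.
Context {C : category}.

Definition is_iso (A B : C) (f : hom A B) : Prop :=
  exists g : hom B A, g ∘ f = idm A /\ f ∘ g = idm B.

Definition mono (A B : C) (m : hom A B) : Prop :=
  forall (X : C) (f g : hom X A), m ∘ f = m ∘ g -> f = g.

(*   P --p--> X
     |q       |f
     Y --g--> Z   *)
Definition is_pullback (P X Y Z : C)
    (p : hom P X) (q : hom P Y) (f : hom X Z) (g : hom Y Z) : Prop :=
  f ∘ p = g ∘ q /\
  forall (W : C) (x : hom W X) (y : hom W Y), f ∘ x = g ∘ y ->
    exists! u : hom W P, p ∘ u = x /\ q ∘ u = y.

End Ordinary.

Record iso (C : category) (A B : C) := Iso {
  fwd :> hom A B;
  bwd : hom B A;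
  fwdK : bwd ∘ fwd = idm A;
  bwdK : fwd ∘ bwd = idm B
}.

Record monoidal := Monoidal {
  mon_cat :> category;
  tensor : mon_cat -> mon_cat -> mon_cat;
  tensorm : forall X X' Y Y' : mon_cat,
    hom X X' -> hom Y Y' -> hom (tensor X Y) (tensor X' Y');
  munitob : mon_cat;
  massoc : forall X Y Z : mon_cat,
    iso (tensor (tensor X Y) Z) (tensor X (tensor Y Z));
  lunit : forall X : mon_cat, iso (tensor munitob X) X;
  runit : forall X : mon_cat, iso (tensor X munitob) X;
  tensorm_id : forall X Y : mon_cat,
    tensorm (idm X) (idm Y) = idm (tensor X Y);
  tensorm_comp : forall (X X' X'' Y Y' Y'' : mon_cat)
      (f' : hom X' X'') (f : hom X X') (g' : hom Y' Y'') (g : hom Y Y'),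
    tensorm (f' ∘ f) (g' ∘ g) = tensorm f' g' ∘ tensorm f g;
  massoc_nat : forall (X X' Y Y' Z Z' : mon_cat)
      (f : hom X X') (g : hom Y Y') (h : hom Z Z'),
    massoc X' Y' Z' ∘ tensorm (tensorm f g) h
    = tensorm f (tensorm g h) ∘ massoc X Y Z;
  lunit_nat : forall (X X' : mon_cat) (f : hom X X'),
    lunit X' ∘ tensorm (idm munitob) f = f ∘ lunit X;
  runit_nat : forall (X X' : mon_cat) (f : hom X X'),
    runit X' ∘ tensorm f (idm munitob) = f ∘ runit X;
  pentagon : forall W X Y Z : mon_cat,
    massoc W X (tensor Y Z) ∘ massoc (tensor W X) Y Z
    = tensorm (idm W) (massoc X Y Z) ∘ massoc W (tensor X Y) Z
        ∘ tensorm (massoc W X Y) (idm Z);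
  triangle : forall X Y : mon_cat,
    tensorm (idm X) (lunit Y) ∘ massoc X munitob Y
    = tensorm (runit X) (idm Y)
}.
Arguments munitob {_}.

Notation "X ⊗ Y" := (tensor X Y) : cat_scope.
Notation "f ⊗m g" := (tensorm f g) : cat_scope.

Record symmetric_monoidal := SymmetricMonoidal {
  sym_mon :> monoidal;
  braid : forall X Y : sym_mon, hom (X ⊗ Y) (Y ⊗ X);
  braid_nat : forall (X X' Y Y' : sym_mon) (f : hom X X') (g : hom Y Y'),
    braid X' Y' ∘ (f ⊗m g) = (g ⊗m f) ∘ braid X Y;
  braidK : forall X Y : sym_mon, braid Y X ∘ braid X Y = idm (X ⊗ Y);
  hexagon : forall X Y Z : sym_mon,
    massoc Y Z X ∘ braid X (Y ⊗ Z) ∘ massoc X Y Z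
    = (idm Y ⊗m braid X Z) ∘ massoc Y X Z ∘ (braid X Y ⊗m idm Z);
  braid_unit : forall X : sym_mon, lunit X ∘ braid X munitob = runit X
}.

Record symmetric_monoidal_closed := SymmetricMonoidalClosed {
  smc_sym :> symmetric_monoidal;
  ihom : smc_sym -> smc_sym -> smc_sym;
  ev : forall Y Z : smc_sym, hom (ihom Y Z ⊗ Y) Z;
  curry : forall X Y Z : smc_sym, hom (X ⊗ Y) Z -> hom X (ihom Y Z);
  curryK : forall (X Y Z : smc_sym) (f : hom (X ⊗ Y) Z),
    ev Y Z ∘ (curry f ⊗m idm Y) = f;
  curry_uniq : forall (X Y Z : smc_sym) (g : hom X (ihom Y Z)),
    curry (ev Y Z ∘ (g ⊗m idm Y)) = g
}.

Section IsoCancel.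
Context {C : category}.

Lemma iso_monoP (A B : C) (i : iso A B) X (f g : hom X A) :
  i ∘ f = i ∘ g -> f = g.
Proof.
by move=> e; rewrite -(comp1m f) -(comp1m g) -(fwdK i) -!compA e.
Qed.

Lemma iso_epiP (A B : C) (i : iso A B) X (f g : hom B X) :
  f ∘ i = g ∘ i -> f = g.
Proof.
by move=> e; rewrite -(compm1 f) -(compm1 g) -(bwdK i) !compA e.
Qed.

End IsoCancel.

Section Coherence.
Context {V : monoidal}.

Lemma tensorm_split (X X' Y Y' : V) (f : hom X X') (g : hom Y Y') :
  f ⊗m g = (f ⊗m idm Y') ∘ (idm X ⊗m g).
Proof. by rewrite -tensorm_comp compm1 comp1m. Qed.

Lemma tensorm_split' (X X' Y Y' : V) (f : hom X X') (g : hom Y Y') :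
  f ⊗m g = (idm X' ⊗m g) ∘ (f ⊗m idm Y).
Proof. by rewrite -tensorm_comp compm1 comp1m. Qed.

Lemma tensorml (X X' X'' Y : V) (g : hom X' X'') (f : hom X X') :
  (g ∘ f) ⊗m idm Y = (g ⊗m idm Y) ∘ (f ⊗m idm Y).
Proof. by rewrite -tensorm_comp compm1. Qed.

Lemma tensormr (X Y Y' Y'' : V) (g : hom Y' Y'') (f : hom Y Y') :
  idm X ⊗m (g ∘ f) = (idm X ⊗m g) ∘ (idm X ⊗m f).
Proof. by rewrite -tensorm_comp compm1. Qed.

Lemma unit_tensorm_inj (X Y : V) (f g : hom X Y) :
  idm munitob ⊗m f = idm munitob ⊗m g -> f = g.
Proof.
by move=> e; apply: (iso_epiP (i := lunit X)); rewrite -!lunit_nat e.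
Qed.

Lemma tensorm_unit_inj (X Y : V) (f g : hom X Y) :
  f ⊗m idm munitob = g ⊗m idm munitob -> f = g.
Proof.
by move=> e; apply: (iso_epiP (i := runit X)); rewrite -!runit_nat e.
Qed.

Definition tensor_isol (X X' Y : V) (i : iso X X') : iso (X ⊗ Y) (X' ⊗ Y).
Proof.
exists (i ⊗m idm Y) (bwd i ⊗m idm Y).
- by rewrite -tensorml fwdK tensorm_id.
- by rewrite -tensorml bwdK tensorm_id.
Defined.

Definition tensor_isor (X Y Y' : V) (i : iso Y Y') : iso (X ⊗ Y) (X ⊗ Y').
Proof.
exists (idm X ⊗m i) (idm X ⊗m bwd i).
- by rewrite -tensormr fwdK tensorm_id.
- by rewrite -tensormr bwdK tensorm_id.
Defined.

Lemma lunit_tensor (X Y : V) :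
  lunit (X ⊗ Y) ∘ massoc munitob X Y = lunit X ⊗m idm Y.
Proof.
apply: unit_tensorm_inj.
apply: (iso_epiP (i := massoc munitob (munitob ⊗ X) Y)).
apply: (iso_epiP (i := tensor_isol Y (massoc munitob munitob X))) => /=.
rewrite tensormr -!compA (compA (idm _ ⊗m massoc _ _ _)) -pentagon compA.
rewrite triangle !compA -massoc_nat -(compA (massoc _ _ _)) -tensorml.
by rewrite triangle massoc_nat tensorm_id.
Qed.

Lemma runit_tensor (X Y : V) :
  (idm X ⊗m runit Y) ∘ massoc X Y munitob = runit (X ⊗ Y).
Proof.
apply: tensorm_unit_inj.
apply: (iso_monoP (i := massoc X Y munitob)).
rewrite tensorml compA massoc_nat -triangle tensormr -!compA.
by rewrite compA -!compA (compA (idm X ⊗m massoc _ _ _)) -pentagon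
   -triangle !compA -massoc_nat tensorm_id.
Qed.

Lemma lunit_unit : lunit munitob = runit munitob :> hom _ (munitob : V).
Proof.
apply: tensorm_unit_inj; rewrite -triangle -lunit_tensor; congr (_ ∘ _).
by apply: (iso_monoP (i := lunit munitob)); rewrite lunit_nat.
Qed.

Lemma bwd_lunit_nat (X X' : V) (f : hom X X') :
  bwd (lunit X') ∘ f = (idm munitob ⊗m f) ∘ bwd (lunit X).
Proof.
apply: (iso_monoP (i := lunit X')).
by rewrite !compA lunit_nat bwdK comp1m -compA bwdK compm1.
Qed.

Lemma bwd_runit_nat (X X' : V) (f : hom X X') :
  bwd (runit X') ∘ f = (f ⊗m idm munitob) ∘ bwd (runit X).
Proof.
apply: (iso_monoP (i := runit X')).
by rewrite !compA runit_nat bwdK comp1m -compA bwdK compm1.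
Qed.

Lemma bwd_lunit_tensor (X Y : V) :
  massoc munitob X Y ∘ (bwd (lunit X) ⊗m idm Y) = bwd (lunit (X ⊗ Y)).
Proof.
apply: (iso_monoP (i := lunit (X ⊗ Y))).
by rewrite compA lunit_tensor -tensorml !bwdK tensorm_id.
Qed.

Lemma bwd_runit_tensor (X Y : V) :
  massoc X Y munitob ∘ bwd (runit (X ⊗ Y)) = idm X ⊗m bwd (runit Y).
Proof.
apply: (iso_monoP (i := tensor_isor X (runit Y))) => /=.
by rewrite compA runit_tensor -tensormr !bwdK tensorm_id.
Qed.

Lemma bwd_triangle (X Y : V) :
  massoc X munitob Y ∘ (bwd (runit X) ⊗m idm Y) = idm X ⊗m bwd (lunit Y).
Proof.
apply: (iso_monoP (i := tensor_isor X (lunit Y))) => /=.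
by rewrite compA triangle -tensorml -tensormr !bwdK !tensorm_id.
Qed.

Lemma bwd_lunit_unit : bwd (lunit munitob) = bwd (runit (munitob : V)).
Proof.
by apply: (iso_monoP (i := lunit munitob)); rewrite bwdK lunit_unit bwdK.
Qed.

End Coherence.

Section SymCoherence.
Context {V : symmetric_monoidal}.

Lemma braid_unitr (X : V) : runit X ∘ braid munitob X = lunit X.
Proof. by rewrite -braid_unit -compA braidK compm1. Qed.

Lemma braid_assoc (X Y Z : V) :
  braid (Y ⊗ X) Z ∘ (braid X Y ⊗m idm Z)
  = massoc Z Y X ∘ braid X (Z ⊗ Y) ∘ (idm X ⊗m braid Y Z) ∘ massoc X Y Z.
Proof.
have H : massoc Z Y X ∘ braid X (Z ⊗ Y) ∘ (idm X ⊗m braid Y Z)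
      = massoc Z Y X ∘ (braid Y Z ⊗m idm X) ∘ braid X (Y ⊗ Z).
  by rewrite -!compA braid_nat.
rewrite {}H.
have {1}-> : braid X (Y ⊗ Z) = bwd (massoc Y Z X)
    ∘ ((idm Y ⊗m braid X Z) ∘ massoc Y X Z ∘ (braid X Y ⊗m idm Z))
    ∘ bwd (massoc X Y Z).
  rewrite -hexagon -!compA bwdK compm1 compA fwdK comp1m //.
rewrite -!compA fwdK compm1 !compA; congr (_ ∘ _).
have Hz := hexagon Z Y X.
have -> : braid (Y ⊗ X) Z = massoc Z Y X ∘ (braid Y Z ⊗m idm X)
    ∘ bwd (massoc Y Z X) ∘ (idm Y ⊗m braid X Z)
    ∘ (massoc Y X Z ∘ braid Z (Y ⊗ X) ∘ massoc Z Y X)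
    ∘ bwd (massoc Z Y X) ∘ braid (Y ⊗ X) Z.
  rewrite Hz.
  have -> : massoc Z Y X ∘ (braid Y Z ⊗m idm X) ∘ bwd (massoc Y Z X)
      ∘ (idm Y ⊗m braid X Z)
      ∘ ((idm Y ⊗m braid Z X) ∘ massoc Y Z X ∘ (braid Z Y ⊗m idm X))
    = massoc Z Y X.
    rewrite !compA -(compA _ (idm Y ⊗m braid X Z)) -tensormr braidK tensorm_id.
    rewrite compm1 -(compA _ (bwd _)) fwdK compm1 -(compA (massoc _ _ _)).
    by rewrite -tensorml braidK tensorm_id compm1.
  by rewrite bwdK comp1m.
rewrite !compA -(compA _ (massoc Z Y X) (bwd _)) bwdK compm1.
by rewrite -(compA _ (braid Z _)) braidK compm1.
Qed.

End SymCoherence.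

Record vcat (V : symmetric_monoidal_closed) := VCat {
  vobj : Type;
  vhom : vobj -> vobj -> V;
  vid : forall A, hom munitob (vhom A A);
  vcomp : forall A B C, hom (vhom B C ⊗ vhom A B) (vhom A C);
  vcompA : forall A B C D,
    vcomp A B D ∘ (vcomp B C D ⊗m idm (vhom A B))
    = vcomp A C D ∘ (idm (vhom C D) ⊗m vcomp A B C)
        ∘ massoc (vhom C D) (vhom B C) (vhom A B);
  vcomp1m : forall A B,
    vcomp A B B ∘ (vid B ⊗m idm (vhom A B)) = lunit (vhom A B);
  vcompm1 : forall A B,
    vcomp A A B ∘ (idm (vhom A B) ⊗m vid A) = runit (vhom A B)
}.
Arguments vhom {_} _ _ _.
Arguments vid {_} _ _.
Arguments vcomp {_} _ _ _ _.

Section Underlying.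
Variables (V : symmetric_monoidal_closed) (B : vcat V).
Implicit Types A : vobj B.

Let mor A1 A2 := hom munitob (vhom B A1 A2).
Let mcomp A1 A2 A3 (g : mor A2 A3) (f : mor A1 A2) : mor A1 A3 :=
  vcomp B A1 A2 A3 ∘ (g ⊗m f) ∘ bwd (lunit munitob).

Lemma mcompA A1 A2 A3 A4 (h : mor A3 A4) (g : mor A2 A3) (f : mor A1 A2) :
  mcomp h (mcomp g f) = mcomp (mcomp h g) f.
Proof.
rewrite /mcomp.
have -> : h ⊗m (vcomp B A1 A2 A3 ∘ (g ⊗m f) ∘ bwd (lunit munitob))
  = (idm _ ⊗m vcomp B A1 A2 A3) ∘ (h ⊗m (g ⊗m f))
      ∘ (idm _ ⊗m bwd (lunit munitob)).
  by rewrite -!tensorm_comp comp1m compm1.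
have -> : (vcomp B A2 A3 A4 ∘ (h ⊗m g) ∘ bwd (lunit munitob)) ⊗m f
  = (vcomp B A2 A3 A4 ⊗m idm _) ∘ ((h ⊗m g) ⊗m f)
      ∘ (bwd (lunit munitob) ⊗m idm _).
  by rewrite -!tensorm_comp comp1m compm1.
rewrite !compA vcompA -!compA; do 2 congr (_ ∘ _).
rewrite (compA (massoc _ _ _)) massoc_nat -!compA; congr (_ ∘ _).
rewrite (compA (massoc _ _ _)); congr (_ ∘ _).
by rewrite bwd_lunit_unit bwd_triangle bwd_lunit_unit.
Qed.

Lemma mcomp1m A1 A2 (f : mor A1 A2) : mcomp (vid B A2) f = f.
Proof.
rewrite /mcomp tensorm_split compA vcomp1m lunit_nat -compA bwdK.
exact: compm1.
Qed.

Lemma mcompm1 A1 A2 (f : mor A1 A2) : mcomp f (vid B A1) = f.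
Proof.
rewrite /mcomp tensorm_split' compA vcompm1 runit_nat -compA.
by rewrite bwd_lunit_unit bwdK compm1.
Qed.

Definition underlying : category := Category mcompA mcomp1m mcompm1.

End Underlying.

Canonical underlying.
Coercion underlying : vcat >-> category.

Section PrePost.
Context {V : symmetric_monoidal_closed} {B : vcat V}.

(* [post A m] is B(A, m) and [pre e A] is B(e, A). *)
Definition post (A : B) (B1 B2 : B) (m : hom B1 B2) :
    hom (vhom B A B1) (vhom B A B2) :=
  vcomp B A B1 B2 ∘ (m ⊗m idm (vhom B A B1)) ∘ bwd (lunit (vhom B A B1)).

Definition pre (A1 A2 : B) (e : hom A1 A2) (A : B) :
    hom (vhom B A2 A) (vhom B A1 A) :=
  vcomp B A1 A2 A ∘ (idm (vhom B A2 A) ⊗m e) ∘ bwd (runit (vhom B A2 A)).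

Lemma postE (A B1 B2 : B) (m : hom B1 B2) (f : hom A B1) :
  post A m ∘ (f : hom munitob (vhom B A B1)) = m ∘ f.
Proof.
rewrite /post -!compA bwd_lunit_nat; rewrite /= -!compA; congr (_ ∘ _).
by rewrite compA -tensorm_split.
Qed.

Lemma preE (A1 A2 A : B) (e : hom A1 A2) (f : hom A2 A) :
  pre e A ∘ (f : hom munitob (vhom B A2 A)) = f ∘ e.
Proof.
rewrite /pre -!compA bwd_runit_nat; rewrite /= -!compA; congr (_ ∘ _).
by rewrite compA -tensorm_split' bwd_lunit_unit.
Qed.

Lemma post_id (A B1 : B) : post A (idm B1) = idm (vhom B A B1).
Proof. by rewrite /post vcomp1m bwdK. Qed.

Lemma pre_id (A1 A : B) : pre (idm A1) A = idm (vhom B A1 A).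
Proof. by rewrite /pre vcompm1 bwdK. Qed.

End PrePost.

Section Opposite.
Variables (V : symmetric_monoidal_closed) (B : vcat V).

Let ocomp (A1 A2 A3 : vobj B) :
    hom (vhom B A3 A2 ⊗ vhom B A2 A1) (vhom B A3 A1) :=
  vcomp B A3 A2 A1 ∘ braid (vhom B A3 A2) (vhom B A2 A1).

Lemma ocompA A1 A2 A3 A4 :
  ocomp A1 A2 A4 ∘ (ocomp A2 A3 A4 ⊗m idm (vhom B A2 A1))
  = ocomp A1 A3 A4 ∘ (idm (vhom B A4 A3) ⊗m ocomp A1 A2 A3)
      ∘ massoc (vhom B A4 A3) (vhom B A3 A2) (vhom B A2 A1).
Proof.
rewrite /ocomp tensorml tensormr !compA.
rewrite -(compA _ (braid _ _) (vcomp _ _ _ _ ⊗m _)) braid_nat.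
rewrite -(compA _ (braid _ _) (_ ⊗m vcomp _ _ _ _)) braid_nat.
rewrite !compA vcompA -!compA; do 2 congr (_ ∘ _).
by rewrite braid_assoc -!compA.
Qed.

Lemma ocomp1m A1 A2 :
  ocomp A1 A2 A2 ∘ (vid B A2 ⊗m idm (vhom B A2 A1)) = lunit (vhom B A2 A1).
Proof. by rewrite /ocomp -compA braid_nat compA vcompm1 braid_unitr. Qed.

Lemma ocompm1 A1 A2 :
  ocomp A1 A1 A2 ∘ (idm (vhom B A2 A1) ⊗m vid B A1) = runit (vhom B A2 A1).
Proof. by rewrite /ocomp -compA braid_nat compA vcomp1m braid_unit. Qed.

Definition vop : vcat V :=
  @VCat V (vobj B) (fun A1 A2 => vhom B A2 A1) (vid B) ocomp
    ocompA ocomp1m ocompm1.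

End Opposite.

Section FullSub.
Variables (V : symmetric_monoidal_closed) (B : vcat V) (P : B -> Prop).

Definition full_sub : vcat V :=
  @VCat V {A : B | P A}
    (fun A1 A2 => vhom B (proj1_sig A1) (proj1_sig A2))
    (fun A => vid B (proj1_sig A))
    (fun A1 A2 A3 => vcomp B (proj1_sig A1) (proj1_sig A2) (proj1_sig A3))
    (fun A1 A2 A3 A4 => vcompA (proj1_sig A1) (proj1_sig A2)
                               (proj1_sig A3) (proj1_sig A4))
    (fun A1 A2 => vcomp1m (proj1_sig A1) (proj1_sig A2))
    (fun A1 A2 => vcompm1 (proj1_sig A1) (proj1_sig A2)).

Definition replete : Prop :=
  forall (A1 A2 : B) (f : hom A1 A2), is_iso f -> P A1 -> P A2.

End FullSub.

Record vfunctor (V : symmetric_monoidal_closed) (B C : vcat V) := VFunctor {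
  fobj :> B -> C;
  fhom : forall A1 A2 : B, hom (vhom B A1 A2) (vhom C (fobj A1) (fobj A2));
  fhom_id : forall A : B, fhom A A ∘ vid B A = vid C (fobj A);
  fhom_comp : forall A1 A2 A3 : B,
    fhom A1 A3 ∘ vcomp B A1 A2 A3
    = vcomp C (fobj A1) (fobj A2) (fobj A3) ∘ (fhom A2 A3 ⊗m fhom A1 A2)
}.
Arguments fhom {_ _ _} _ _ _.

Section Functors.
Context {V : symmetric_monoidal_closed}.

Definition fmap (B C : vcat V) (F : vfunctor B C) (A1 A2 : B)
    (f : hom A1 A2) : hom (F A1) (F A2) :=
  fhom F A1 A2 ∘ (f : hom munitob (vhom B A1 A2)).

Definition vfid (B : vcat V) : vfunctor B B.
Proof.
refine (@VFunctor V B B id (fun A1 A2 => idm (vhom B A1 A2)) _ _).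
- by move=> A; rewrite comp1m.
- by move=> A1 A2 A3; rewrite comp1m tensorm_id compm1.
Defined.

Definition vfcomp (B C D : vcat V) (G : vfunctor C D) (F : vfunctor B C) :
  vfunctor B D.
Proof.
refine (@VFunctor V B D (fun A => G (F A))
          (fun A1 A2 => fhom G (F A1) (F A2) ∘ fhom F A1 A2) _ _).
- by move=> A; rewrite -compA fhom_id fhom_id.
- move=> A1 A2 A3; rewrite -compA fhom_comp compA fhom_comp -compA.
  by rewrite -tensorm_comp.
Defined.

Definition incl (B : vcat V) (P : B -> Prop) : vfunctor (full_sub P) B.
Proof.
refine (@VFunctor V (full_sub P) B (fun A => proj1_sig A)
          (fun A1 A2 => idm (vhom B (proj1_sig A1) (proj1_sig A2))) _ _).
- by move=> A; rewrite comp1m.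
- by move=> A1 A2 A3; rewrite comp1m tensorm_id compm1.
Defined.

Definition corestrict (B C : vcat V) (P : B -> Prop) (G : vfunctor C B)
  (GP : forall X : C, P (G X)) : vfunctor C (full_sub P).
Proof.
refine (@VFunctor V C (full_sub P) (fun X => exist P (G X) (GP X))
          (fun X1 X2 => fhom G X1 X2) _ _).
- by move=> X; apply: fhom_id.
- by move=> X1 X2 X3; apply: fhom_comp.
Defined.

Definition conservative (B C : vcat V) (F : vfunctor B C) : Prop :=
  forall (A1 A2 : B) (f : hom A1 A2), is_iso (fmap F f) -> is_iso f.

Lemma fmap_id (B C : vcat V) (F : vfunctor B C) (A : B) :
  fmap F (idm A) = idm (F A).
Proof. exact: fhom_id. Qed.

Lemma fmap_comp (B C : vcat V) (F : vfunctor B C) (A1 A2 A3 : B)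
    (g : hom A2 A3) (f : hom A1 A2) :
  fmap F (g ∘ f) = fmap F g ∘ fmap F f.
Proof. by rewrite /fmap /= !compA fhom_comp tensorm_comp !compA. Qed.

Lemma fhom_post (B C : vcat V) (F : vfunctor B C) (A B1 B2 : B)
    (m : hom B1 B2) :
  fhom F A B2 ∘ post A m = post (F A) (fmap F m) ∘ fhom F A B1.
Proof.
rewrite /post /fmap -[RHS]compA bwd_lunit_nat !compA fhom_comp.
by rewrite -![in LHS]compA -![in RHS]compA; congr (_ ∘ _);
   rewrite !compA -!tensorm_comp compm1 comp1m compm1.
Qed.

Lemma fhom_pre (B C : vcat V) (F : vfunctor B C) (A1 A2 A : B)
    (e : hom A1 A2) :
  fhom F A1 A ∘ pre e A = pre (fmap F e) (F A) ∘ fhom F A2 A.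
Proof.
rewrite /pre /fmap -[RHS]compA bwd_runit_nat !compA fhom_comp.
by rewrite -![in LHS]compA -![in RHS]compA; congr (_ ∘ _);
   rewrite !compA -!tensorm_comp compm1 comp1m compm1.
Qed.

End Functors.

Record vnat (V : symmetric_monoidal_closed) (B C : vcat V)
    (F G : vfunctor B C) := VNat {
  ncomp :> forall A : B, hom (F A) (G A);
  vnatural : forall A1 A2 : B,
    post (F A1) (ncomp A2) ∘ fhom F A1 A2
    = pre (ncomp A1) (G A2) ∘ fhom G A1 A2
}.

Lemma vnat_natural (V : symmetric_monoidal_closed) (B C : vcat V)
    (F G : vfunctor B C) (a : vnat F G) (A1 A2 : B) (f : hom A1 A2) :
  a A2 ∘ fmap F f = fmap G f ∘ a A1.
Proof. by rewrite -postE -preE /fmap compA vnatural -compA. Qed.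

Record vmonad (V : symmetric_monoidal_closed) (B : vcat V) := VMonad {
  mfun :> vfunctor B B;
  munit : vnat (vfid B) mfun;
  mmult : vnat (vfcomp mfun mfun) mfun;
  mmult_unitl : forall A : B, mmult A ∘ munit (mfun A) = idm (mfun A);
  mmult_unitr : forall A : B, mmult A ∘ fmap mfun (munit A) = idm (mfun A);
  mmult_assoc : forall A : B,
    mmult A ∘ mmult (mfun A) = mmult A ∘ fmap mfun (mmult A)
}.

Record vmonad_mor (V : symmetric_monoidal_closed) (B : vcat V)
    (S T : vmonad B) := VMonadMor {
  mor_nat :> vnat S T;
  mor_unit : forall A : B, mor_nat A ∘ munit S A = munit T A;
  mor_mult : forall A : B,
    mor_nat A ∘ mmult S A
    = mmult T A ∘ fmap T (mor_nat A) ∘ mor_nat (S A)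
}.

Section Monads.
Context {V : symmetric_monoidal_closed} {B : vcat V}.

Definition is_vnat_iso (F G : vfunctor B B) (a : vnat F G) : Prop :=
  exists b : vnat G F,
    forall A : B, b A ∘ a A = idm (F A) /\ a A ∘ b A = idm (G A).

Definition idempotent (T : vmonad B) : Prop := is_vnat_iso (mmult T).

Definition sigma (T : vfunctor B B) (A1 A2 : B) (f : hom A1 A2) : Prop :=
  is_iso (fmap T f).

Definition idempotent_core (T S : vmonad B) : Prop :=
  idempotent S /\
  forall (A1 A2 : B) (f : hom A1 A2), sigma S f <-> sigma T f.

(* Objects of the V-reflective subcategory determined by an idempotent
   V-monad. *)
Definition reflective_of (S : vmonad B) (A : B) : Prop := is_iso (munit S A).

End Monads.

Record vadjunction (V : symmetric_monoidal_closed) (B C : vcat V)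
    (F : vfunctor B C) (G : vfunctor C B) := VAdjunction {
  aunit : vnat (vfid B) (vfcomp G F);
  acounit : vnat (vfcomp F G) (vfid C);
  triangle_l : forall A : B, acounit (F A) ∘ fmap F (aunit A) = idm (F A);
  triangle_r : forall X : C, fmap G (acounit X) ∘ aunit (G X) = idm (G X)
}.

Section Adjunctions.
Context {V : symmetric_monoidal_closed}.

Section InducedMonad.
Variables (B C : vcat V) (F : vfunctor B C) (G : vfunctor C B).
Variable a : vadjunction F G.

Definition induced_mult :
  vnat (vfcomp (vfcomp G F) (vfcomp G F)) (vfcomp G F).
Proof.
refine (@VNat V B B (vfcomp (vfcomp G F) (vfcomp G F)) (vfcomp G F)
          (fun A => fmap G (acounit a (F A))) _) => A1 A2 /=.
have H := vnatural (acounit a) (F A1) (F A2); rewrite /= compm1 in H.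
by rewrite !compA -fhom_post -fhom_pre -H !compA.
Defined.

Lemma fmap_vfcomp (B1 B2 B3 : vcat V) (G' : vfunctor B2 B3)
    (F' : vfunctor B1 B2) (A1 A2 : B1) (f : hom A1 A2) :
  fmap (vfcomp G' F') f = fmap G' (fmap F' f).
Proof. by rewrite /fmap /= compA. Qed.

Definition induced_monad : vmonad B.
Proof.
refine (@VMonad V B (vfcomp G F) (aunit a) induced_mult _ _ _) => A.
- exact: (triangle_r a (F A)).
- rewrite fmap_vfcomp -[LHS](fmap_comp G) triangle_l; exact: (fmap_id G (F A)).
- rewrite fmap_vfcomp -[LHS](fmap_comp G) -[RHS](fmap_comp G).
  congr (fmap G _).
  have H := vnat_natural (acounit a) (acounit a (F A)).
  by rewrite fmap_vfcomp in H; rewrite H /fmap /= comp1m.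
Defined.

(* The adjunction gives rise to the monad [T] on the nose: same endofunctor
   [G F], same unit, and multiplication [G (counit) F]. *)
Definition induces (T : vmonad B) : Prop := induced_monad = T.

End InducedMonad.

(* V-reflections onto full subcategories, the latter given by their objects *)
Record vreflection (B : vcat V) (P : B -> Prop) := VReflection {
  refl_replete : replete P;
  refl_fun : vfunctor B (full_sub P);
  refl_adj : vadjunction refl_fun (incl P)
}.

Section Factor.
Variables (B C : vcat V) (F : vfunctor B C) (G : vfunctor C B).
Variables (a : vadjunction F G) (P : B -> Prop).

Definition factors_through (_ : vadjunction F G) (_ : vreflection P) : Prop :=
  forall X : C, P (G X).

Definition induced_left (_ : vadjunction F G) (_ : vreflection P) :
  vfunctor (full_sub P) C := vfcomp F (incl P).

Variables (r : vreflection P) (GP : factors_through a r).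
Let F' : vfunctor (full_sub P) C := induced_left a r.

Definition induced_unit : vnat (vfid (full_sub P)) (vfcomp (corestrict GP) F').
Proof.
refine (@VNat V _ _ (vfid (full_sub P)) (vfcomp (corestrict GP) F')
          (fun A => aunit a (proj1_sig A)) _) => A1 A2.
rewrite /= (compm1 (fhom F _ _)).
exact: (vnatural (aunit a) (proj1_sig A1) (proj1_sig A2)).
Defined.

Definition induced_counit : vnat (vfcomp F' (corestrict GP)) (vfid C).
Proof.
refine (@VNat V _ _ (vfcomp F' (corestrict GP)) (vfid C)
          (fun X => acounit a X) _) => X1 X2.
rewrite /= (compm1 (fhom F _ _)); exact: (vnatural (acounit a) X1 X2).
Defined.

Definition induced_adjunction : vadjunction F' (corestrict GP).
Proof.
refine (@VAdjunction V _ _ F' (corestrict GP)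
          induced_unit induced_counit _ _).
- move=> A; rewrite /F' /induced_left fmap_vfcomp {2}/fmap /= comp1m.
  exact: (triangle_l a (proj1_sig A)).
- by move=> X; apply: (triangle_r a X).
Defined.

End Factor.
End Adjunctions.

Definition morphisms (C : category) := forall A1 A2 : C, hom A1 A2 -> Prop.

Section Factorization.
Context {V : symmetric_monoidal_closed} {B : vcat V}.

Definition vmono (B1 B2 : B) (m : hom B1 B2) : Prop :=
  forall A : B, mono (post A m).

Definition vorth (A1 A2 : B) (e : hom A1 A2) (B1 B2 : B) (m : hom B1 B2) :
    Prop :=
  is_pullback (pre e B1) (post A2 m) (post A1 m) (pre e B2).

Definition vdown (E : morphisms B) : morphisms B := fun B1 B2 m =>
  forall (A1 A2 : B) (e : hom A1 A2), E A1 A2 e -> vorth e m.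

Definition vup (M : morphisms B) : morphisms B := fun A1 A2 e =>
  forall (B1 B2 : B) (m : hom B1 B2), M B1 B2 m -> vorth e m.

Definition meet (M N : morphisms B) : morphisms B := fun A1 A2 f =>
  M A1 A2 f /\ N A1 A2 f.

Definition same (M N : morphisms B) : Prop :=
  forall (A1 A2 : B) (f : hom A1 A2), M A1 A2 f <-> N A1 A2 f.

Definition factorizes (E M : morphisms B) : Prop :=
  forall (A1 A2 : B) (f : hom A1 A2),
    exists (D : B) (e : hom A1 D) (m : hom D A2),
      E A1 D e /\ M D A2 m /\ f = m ∘ e.

Definition vprefactorization_system (E M : morphisms B) : Prop :=
  same (vdown E) M /\ same (vup M) E.

Definition vfactorization_system (E M : morphisms B) : Prop :=
  vprefactorization_system E M /\ factorizes E M.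

End Factorization.

Definition vepi {V : symmetric_monoidal_closed} {B : vcat V} (A1 A2 : B)
  (e : hom A1 A2) : Prop := @vmono V (vop B) A2 A1 e.

Lemma vepiE (V : symmetric_monoidal_closed) (B : vcat V) (A1 A2 : B)
    (e : hom A1 A2) :
  vepi e <-> forall A : B, mono (pre e A).
Proof.
have H (A : B) : @post V (vop B) A A2 A1 e = pre e A.
  rewrite /post /pre /= -(compA _ (braid _ _)) braid_nat -!compA.
  congr (_ ∘ (_ ∘ _)); apply: (iso_monoP (i := runit _)).
  by rewrite compA braid_unitr !bwdK.
by split=> h A; have := h A; rewrite H.
Qed.

Definition vproper {V : symmetric_monoidal_closed} {B : vcat V}
    (E M : morphisms B) : Prop :=
  (forall (A1 A2 : B) (e : hom A1 A2), E A1 A2 e -> vepi e) /\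
  (forall (B1 B2 : B) (m : hom B1 B2), M B1 B2 m -> vmono m).

Section Relative.
Context {V : symmetric_monoidal_closed} {B : vcat V}.
Variables (M : morphisms B) (T : vmonad B).

Definition Tcomplete (A : B) : Prop :=
  forall (A1 A2 : B) (h : hom A1 A2), sigma T h -> is_iso (pre h A).

Definition Tseparated (A : B) : Prop := M (munit T A).

Definition Tclosed : morphisms B := meet (vdown (@sigma V B T)) M.

Definition Tdense : morphisms B := vup Tclosed.

End Relative.

(* Main.v *)
From mathcomp Require Import ssreflect ssrfun.
Require Import Defs.
From Stdlib Require Import FunctionalExtensionality ProofIrrelevance
  IndefiniteDescription.

Set Implicit Arguments.
Unset Strict Implicit.
Unset Printing Implicit Defensive.

Local Open Scope cat_scope.

(** Call [r : A -> D] a completion of [A] when [T] inverts [r] and [D] is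
    [T]-complete.  If every object has a completion, the [r] are universal
    arrows to [T]-complete objects in the enriched sense, since [pre r X] is
    invertible for complete [X]; so they assemble into a [V]-monad, and this is
    the idempotent core.  Conversely the unit of any idempotent core consists of
    completions.  As completions of [A] are unique up to isomorphism, every
    claim about an arbitrary core can be checked on one chosen completion.

    The heart of the matter is thus [dense_closed_completion]: if the unit
    [η_A : A -> T A] factors as a [T]-dense [ρ : A -> D] followed by a
    [T]-closed embedding [ι : D -> T A], then [ρ] is a completion.  Free algebras
    are complete, as is any object whose unit has a retraction
    ([retract_complete]), and closed subobjects of complete objects are complete
    because isomorphisms are stable under pullback; so [D] is complete.  It
    remains to invert [T ρ].  The map [a := μ_A ∘ T ι] satisfies
    [a ∘ T ρ = μ_A ∘ T η_A = id].  For the other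
    composite, [a ∘ η_D = ι] lies in [M], hence so does [η_D] by properness,
    and [η_D] is [T]-closed since both its ends are complete.  Density of [ρ],
    tested against [η_D] on the square [η_D ∘ ρ = (T ρ ∘ ι) ∘ ρ], gives
    [d : D -> D] with [η_D ∘ d = T ρ ∘ ι].  Applying [a] yields [ι ∘ d = ι], so
    [d] is the identity and [T ρ ∘ ι = η_D]; applying [T] and then [μ_D] turns
    this into [T ρ ∘ a = id].

    The remaining claims follow.  For a complete [A] the identity is a
    completion, so [η_A] itself is a closed embedding.  If [F ⊣ G] induces [T],
    the counit retracts the unit at [G X], so [G X] is complete; and an arrow
    inverted by [F] is inverted by [T], hence is invertible as soon as its ends
    are complete. *)

(** * Isomorphisms and pullbacks *)

Section Isomorphisms.
Context {C : category}.

Lemma is_iso_id (A : C) : is_iso (idm A).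
Proof. by exists (idm A); rewrite comp1m. Qed.

Lemma is_iso_comp (A1 A2 A3 : C) (g : hom A2 A3) (f : hom A1 A2) :
  is_iso g -> is_iso f -> is_iso (g ∘ f).
Proof.
move=> [g' [g'g gg']] [f' [f'f ff']]; exists (f' ∘ g'); split.
- by rewrite compA -(compA f') g'g compm1.
- by rewrite compA -(compA g) ff' compm1.
Qed.

Lemma is_iso_cancell (A1 A2 A3 : C) (g : hom A2 A3) (f : hom A1 A2) :
  is_iso g -> is_iso (g ∘ f) -> is_iso f.
Proof.
move=> [g' [g'g gg']] gf.
have -> : f = g' ∘ (g ∘ f) by rewrite compA g'g comp1m.
by apply: is_iso_comp => //; exists g.
Qed.

Lemma is_iso_cancelr (A1 A2 A3 : C) (g : hom A2 A3) (f : hom A1 A2) :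
  is_iso f -> is_iso (g ∘ f) -> is_iso g.
Proof.
move=> [f' [f'f ff']] gf.
have -> : g = g ∘ f ∘ f' by rewrite -compA ff' compm1.
by apply: is_iso_comp => //; exists f.
Qed.

Lemma is_iso_mono (A1 A2 : C) (m : hom A1 A2) : is_iso m -> mono m.
Proof.
move=> [m' [m'm _]] X f g e.
by rewrite -(comp1m f) -(comp1m g) -m'm -!compA e.
Qed.

Lemma choose_inverse (A1 A2 : C) (f : hom A1 A2) :
  is_iso f -> {g : hom A2 A1 | g ∘ f = idm A1 /\ f ∘ g = idm A2}.
Proof. exact: constructive_indefinite_description. Qed.

End Isomorphisms.

Section Pullbacks.
Context {C : category}.

Lemma pullback_sym (P X Y Z : C) (p : hom P X) (q : hom P Y) (f : hom X Z)
    (g : hom Y Z) : is_pullback p q f g -> is_pullback q p g f.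
Proof.
move=> [e univ]; split=> // W y x exy.
have [u [[pu qu] uniq]] := univ W x y (esym exy).
by exists u; split=> // v [qv pv]; apply: uniq.
Qed.

Lemma pullback_of_iso (P X Y Z : C) (p : hom P X) (q : hom P Y)
    (f : hom X Z) (g : hom Y Z) :
  is_pullback p q f g -> is_iso g -> is_iso p.
Proof.
move=> [e univ] [g' [g'g gg']].
have [|s [[ps qs] _]] := univ X (idm X) (g' ∘ f).
  by rewrite compm1 compA gg' comp1m.
have [u [_ uniq]] := univ P p q e.
exists s; split=> //.
rewrite -(uniq (idm P)) ?compm1 //; symmetry; apply: uniq.
by rewrite !compA ps qs comp1m -compA e compA g'g comp1m.
Qed.

Lemma iso_square_pullback (P X Y Z : C) (p : hom P X) (q : hom P Y)
    (f : hom X Z) (g : hom Y Z) :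
  f ∘ p = g ∘ q -> is_iso p -> is_iso g -> is_pullback p q f g.
Proof.
move=> e [p' [p'p pp']] /is_iso_mono g_mono; split=> // W x y exy.
exists (p' ∘ x); split; first split.
- by rewrite compA pp' comp1m.
- by apply: g_mono; rewrite !compA -e -(compA f) pp' compm1.
- by move=> u [<- _]; rewrite compA p'p comp1m.
Qed.

(** Orthogonality is a pullback condition, so pasting an invertible square onto
    a pullback is what makes orthogonality classes stable under composition with
    isomorphisms. *)
Lemma pullback_iso_paste (P P' X X' Y Z : C)
    (p : hom P X) (p' : hom P' X') (q : hom P' Y) (f : hom X' Z)
    (g : hom Y Z) (i : hom P P') (j : hom X X') :
  is_iso i -> is_iso j -> j ∘ p = p' ∘ i ->
  is_pullback p' q f g -> is_pullback p (q ∘ i) (f ∘ j) g.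
Proof.
move=> i_iso j_iso e [e' univ]; have [i' [i'i ii']] := i_iso.
have j_mono := is_iso_mono j_iso.
split; first by rewrite -compA e !compA e'.
move=> W x y exy.
have [|u [[pu qu] uniq]] := univ W (j ∘ x) y; first by rewrite compA.
exists (i' ∘ u); split; first split.
- by apply: j_mono; rewrite !compA e -(compA p') ii' compm1.
- by rewrite compA -(compA q) ii' compm1.
- move=> v [pv qv]; rewrite (uniq (i ∘ v)) ?compA ?i'i ?comp1m //.
  by rewrite -e -compA pv.
Qed.

End Pullbacks.

(** * The hom bifunctor of an enriched category *)

Section HomFunctors.
Context {V : symmetric_monoidal_closed} {B : vcat V}.
Implicit Types A X Y : B.

(** The three lemmas [post_vcomp], [pre_vcomp] and [vcomp_pre_post] are the
    associativity of [vcomp] with the outer, the inner and the middle morphism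
    respectively specialised to an element of the hom-object; functoriality of
    [post] and [pre] and their commutation are consequences. *)
Lemma post_vcomp A A' X Y (m : hom X Y) :
  post A m ∘ vcomp B A A' X = vcomp B A A' Y ∘ (post A' m ⊗m idm _).
Proof.
rewrite /post !tensorml -!compA bwd_lunit_nat -bwd_lunit_tensor !compA vcompA.
rewrite -![in LHS]compA -![in RHS]compA; congr (_ ∘ _).
rewrite (compA (massoc _ _ _)) massoc_nat tensorm_id.
by rewrite !compA -tensorm_split' -tensorm_split.
Qed.

Lemma pre_vcomp A1 A2 A X (e : hom A1 A2) :
  pre e X ∘ vcomp B A2 A X = vcomp B A1 A X ∘ (idm _ ⊗m pre e A).
Proof.
rewrite /pre !tensormr -!compA bwd_runit_nat -bwd_runit_tensor !compA.
congr (_ ∘ _); rewrite -(compA _ _ (massoc _ _ _)) -massoc_nat tensorm_id.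
rewrite compA -vcompA -[LHS]compA -[RHS]compA.
by rewrite -tensorm_split -tensorm_split'.
Qed.

Lemma vcomp_pre_post A1 A2 A3 X (e : hom A2 A3) :
  vcomp B A1 A2 X ∘ (pre e X ⊗m idm _)
  = vcomp B A1 A3 X ∘ (idm _ ⊗m post A1 e).
Proof.
rewrite /pre /post !tensorml !tensormr !compA vcompA -bwd_triangle.
rewrite -![in LHS]compA -![in RHS]compA; do 2 congr (_ ∘ _).
by rewrite !compA massoc_nat.
Qed.

Lemma post_comp A (X1 X2 X3 : B) (g : hom X2 X3) (f : hom X1 X2) :
  post A (g ∘ f) = post A g ∘ post A f.
Proof.
rewrite {3}/post !compA post_vcomp -(compA _ (post _ g ⊗m _)) -tensorml.
by rewrite postE.
Qed.

Lemma pre_comp (A1 A2 A3 : B) X (g : hom A2 A3) (f : hom A1 A2) :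
  pre (g ∘ f) X = pre f X ∘ pre g X.
Proof.
rewrite {3}/pre !compA pre_vcomp -(compA _ (_ ⊗m pre f _)) -tensormr.
by rewrite preE.
Qed.

Lemma pre_post (A1 A2 : B) (e : hom A1 A2) (X Y : B) (m : hom X Y) :
  post A1 m ∘ pre e X = pre e Y ∘ post A2 m.
Proof.
rewrite {1}/pre [LHS]compA [X in X ∘ bwd _]compA post_vcomp.
rewrite -(compA (vcomp _ _ _ _)) -tensorm_split tensorm_split'.
by rewrite /pre -[RHS]compA bwd_runit_nat !compA.
Qed.

Lemma post_iso A X Y (m : hom X Y) : is_iso m -> is_iso (post A m).
Proof.
by move=> [n [nm mn]]; exists (post A n); rewrite -!post_comp nm mn !post_id.
Qed.

Lemma pre_iso (A1 A2 : B) (e : hom A1 A2) X : is_iso e -> is_iso (pre e X).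
Proof.
by move=> [d [de ed]]; exists (pre d X); rewrite -!pre_comp de ed !pre_id.
Qed.

Lemma pre_mono_cancel (A1 A2 : B) (e : hom A1 A2) X (f g : hom A2 X) :
  mono (pre e X) -> f ∘ e = g ∘ e -> f = g.
Proof. by move=> me fg; apply: me; rewrite !preE. Qed.

Lemma pre_iso_extend (A1 A2 : B) (e : hom A1 A2) X (f : hom A1 X) :
  is_iso (pre e X) -> exists g : hom A2 X, g ∘ e = f.
Proof.
move=> [d [_ ed]]; exists (d ∘ (f : hom munitob (vhom B A1 X)) : hom A2 X).
by rewrite -preE compA ed comp1m.
Qed.

(** A fragment of the Yoneda lemma in which representability need only be tested
    on the two ends of [h]: extend the identity of [X] along [h], and cancel [h]
    on maps into [Y]. *)
Lemma iso_of_pre_iso X Y (h : hom X Y) :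
  is_iso (pre h X) -> is_iso (pre h Y) -> is_iso h.
Proof.
move=> /(pre_iso_extend (idm X)) [d dh] /is_iso_mono hY.
exists d; split=> //; apply: (pre_mono_cancel hY).
by rewrite -compA dh compm1 comp1m.
Qed.

End HomFunctors.

(** * Enriched orthogonality *)

Section Orthogonality.
Context {V : symmetric_monoidal_closed} {B : vcat V}.

(** The enriched pullback, tested on maps out of the monoidal unit, is the
    ordinary diagonal fill-in property. *)
Lemma vorth_lift (A1 A2 X Y : B) (e : hom A1 A2) (m : hom X Y)
    (f : hom A1 X) (g : hom A2 Y) :
  vorth e m -> m ∘ f = g ∘ e -> exists d : hom A2 X, d ∘ e = f /\ m ∘ d = g.
Proof.
move=> [_ univ] sq.
have [|d [[df dg] _]] := univ munitob f g; first by rewrite postE preE.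
by exists d; rewrite -preE -postE.
Qed.

Lemma vorth_iso_compr (A1 A2 X X' Y : B) (e : hom A1 A2) (m : hom X' Y)
    (i : hom X X') : is_iso i -> vorth e m -> vorth e (m ∘ i).
Proof.
move=> i_iso em; rewrite /vorth !post_comp.
by apply: pullback_iso_paste em; rewrite ?pre_post //; apply: post_iso.
Qed.

Lemma vorth_iso_compl (A1 A2 A2' X Y : B) (e : hom A1 A2) (m : hom X Y)
    (i : hom A2 A2') : is_iso i -> vorth e m -> vorth (i ∘ e) m.
Proof.
move=> i_iso /pullback_sym em; rewrite /vorth !pre_comp; apply: pullback_sym.
by apply: pullback_iso_paste em; rewrite ?pre_post //; apply: pre_iso.
Qed.

Lemma vdown_iso_compr (E : morphisms B) (X X' Y : B) (m : hom X' Y)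
    (i : hom X X') : is_iso i -> vdown E m -> vdown E (m ∘ i).
Proof. by move=> i_iso dm A1 A2 e /dm; apply: vorth_iso_compr. Qed.

Lemma vup_iso_compl (M : morphisms B) (A1 A2 A2' : B) (e : hom A1 A2)
    (i : hom A2 A2') : is_iso i -> vup M e -> vup M (i ∘ e).
Proof. by move=> i_iso ue X Y m /ue; apply: vorth_iso_compl. Qed.

(** Factor [f] as [m ∘ e].  Since [g ∘ f] lies in [M], [e] is orthogonal to it,
    which gives a retraction of [e]; being also an epimorphism, [e] is
    invertible, and so [f] is in [M] along with [m]. *)
Lemma right_class_cancel (E M : morphisms B) (X Y Z : B) (g : hom Y Z)
    (f : hom X Y) :
  vfactorization_system E M -> (forall A1 A2 e, E A1 A2 e -> vepi e) ->
  M _ _ (g ∘ f) -> M _ _ f.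
Proof.
move=> [[EM _] fact] E_epi Mgf; have [D [e [m [Ee [Mm def_f]]]]] := fact _ _ f.
have e_gf : vorth e (g ∘ f) by move/EM: Mgf; apply.
have [|d [de _]] := vorth_lift (f := idm X) (g := g ∘ m) e_gf.
  by rewrite compm1 def_f compA.
have e_iso : is_iso e.
  exists d; split=> //.
  have /vepiE e_epi := E_epi _ _ _ Ee.
  by apply: (pre_mono_cancel (e_epi D)); rewrite -compA de compm1 comp1m.
by rewrite def_f; apply/EM; apply: vdown_iso_compr => //; apply/EM.
Qed.

End Orthogonality.

(** * Complete objects and completions *)

Section Completions.
Context {V : symmetric_monoidal_closed} {B : vcat V}.
Implicit Types T S : vmonad B.

Lemma fmap_iso (C D : vcat V) (F : vfunctor C D) (A1 A2 : C) (f : hom A1 A2) :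
  is_iso f -> is_iso (fmap F f).
Proof.
by move=> [g [gf fg]]; exists (fmap F g); rewrite -!fmap_comp gf fg !fmap_id.
Qed.

Lemma munit_natural T (A1 A2 : B) (f : hom A1 A2) :
  munit T A2 ∘ f = fmap T f ∘ munit T A1.
Proof.
have := vnat_natural (munit T) f.
by rewrite {1}/fmap [fhom (vfid B) _ _ ∘ _]comp1m.
Qed.

(** The extension of [f : A1 -> X] along [h] is
    [a ∘ T f ∘ (T h)^-1 ∘ η]; written on hom-objects this composite is the
    inverse of [pre h X]. *)
Lemma retract_complete T (X : B) (a : hom (T X) X) :
  a ∘ munit T X = idm X -> Tcomplete T X.
Proof.
move=> aη A1 A2 h [k [kh hk]].
have ext (A : B) : pre (munit T A) X ∘ post (T A) a ∘ fhom T A X = idm _.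
  have /= nat := vnatural (munit T) A X.
  by rewrite -pre_post -compA -nat compm1 -post_comp aη post_id.
exists (pre (k ∘ munit T A2) X ∘ post (T A1) a ∘ fhom T A1 X); split.
- rewrite -[LHS]compA fhom_pre compA -(compA (pre _ _)) pre_post compA.
  by rewrite -pre_comp (compA (fmap T h)) hk comp1m ext.
- rewrite compA [X in X ∘ _]compA -pre_comp -(compA k) munit_natural.
  by rewrite (compA k) kh comp1m ext.
Qed.

Lemma Tcomplete_free T (A : B) : Tcomplete T (T A).
Proof. exact: retract_complete (mmult_unitl T A). Qed.

Lemma Tcomplete_replete T : replete (Tcomplete T).
Proof.
move=> X Y f f_iso cX A1 A2 h Th.
apply: (is_iso_cancelr (post_iso A2 f_iso)).
rewrite -pre_post; apply: is_iso_comp; [exact: post_iso | exact: cX].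
Qed.

Lemma Tcomplete_closed_sub T (X Y : B) (m : hom X Y) :
  vdown (@sigma V B T) m -> Tcomplete T Y -> Tcomplete T X.
Proof.
move=> dm cY A1 A2 h Th.
exact: pullback_of_iso (dm _ _ _ Th) (cY _ _ _ Th).
Qed.

(** Between complete objects the orthogonality square has two parallel
    invertible sides, so it is a pullback. *)
Lemma vdown_sigma_of_complete T (X Y : B) (m : hom X Y) :
  Tcomplete T X -> Tcomplete T Y -> vdown (@sigma V B T) m.
Proof.
move=> cX cY A1 A2 h Th.
by apply: iso_square_pullback; [exact: pre_post | exact: cX | exact: cY].
Qed.

Lemma sigma_complete_iso T (X Y : B) (h : hom X Y) :
  Tcomplete T X -> Tcomplete T Y -> sigma T h -> is_iso h.
Proof. by move=> cX cY Th; apply: iso_of_pre_iso; [apply: cX | apply: cY]. Qed.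

Definition completion T (A D : B) (r : hom A D) : Prop :=
  sigma T r /\ Tcomplete T D.

Lemma completion_ext T (A D X : B) (r : hom A D) (f g : hom D X) :
  completion T r -> Tcomplete T X -> f ∘ r = g ∘ r -> f = g.
Proof.
by move=> [Tr _] cX; apply: pre_mono_cancel; apply: is_iso_mono; apply: cX.
Qed.

Lemma completion_unique T (A D D' : B) (r : hom A D) (r' : hom A D') :
  completion T r -> completion T r' ->
  exists j : hom D D', is_iso j /\ j ∘ r = r'.
Proof.
move=> [Tr cD] [Tr' cD']; have [j jr] := pre_iso_extend r' (cD' _ _ _ Tr).
exists j; split=> //; apply: (sigma_complete_iso cD cD').
by apply: (is_iso_cancelr Tr); rewrite -fmap_comp jr.
Qed.

End Completions.

(** * Completions from dense-closed factorizations *)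

Section DenseClosed.
Context {V : symmetric_monoidal_closed} {B : vcat V}.
Variables (T : vmonad B) (E M : morphisms B).
Hypothesis EM_fs : vfactorization_system E M.
Hypothesis EM_proper : vproper E M.

(** The factor [ι] of the unit plays two parts: it makes [D] complete, and
    through [a := μ ∘ T ι] it makes [η_D] a closed embedding against which the
    density of [r] can be used. *)
Lemma dense_closed_completion (A D : B) (r : hom A D) (i : hom D (T A)) :
  Tdense M T r -> Tclosed M T i -> munit T A = i ∘ r -> completion T r.
Proof.
move=> dense_r [down_i Mi] def_η.
have cD : Tcomplete T D := Tcomplete_closed_sub down_i (Tcomplete_free A).
split=> //.
pose a := mmult T A ∘ fmap T i.
have aη : a ∘ munit T D = i.
  by rewrite /a -compA -munit_natural compA mmult_unitl comp1m.
have a_r : a ∘ fmap T r = idm (T A).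
  by rewrite /a -compA -fmap_comp -def_η mmult_unitr.
have closed_η : Tclosed M T (munit T D).
  split; first exact: vdown_sigma_of_complete (Tcomplete_free D).
  by apply: (right_class_cancel EM_fs (proj1 EM_proper) (g := a)); rewrite aη.
(* [d] compares the two maps [D -> T D] that agree after [r]. *)
have [|d [dr ηd]] := vorth_lift (f := r) (g := fmap T r ∘ i)
                       (dense_r _ _ _ closed_η).
  by rewrite munit_natural def_η compA.
have d1 : d = idm D.
  have i_mono := proj2 EM_proper _ _ _ Mi D.
  apply: i_mono; rewrite !postE compm1.
  by rewrite -{1}aη -compA ηd compA a_r comp1m.
have η_r : fmap T r ∘ i = munit T D by rewrite -ηd d1 compm1.
exists a; split=> //.
(* [T r ∘ μ ∘ T i = μ ∘ T (T r ∘ i) = μ ∘ T η], the identity. *)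
have := vnat_natural (mmult T) r; rewrite fmap_vfcomp => mult_nat.
by rewrite /a compA -mult_nat -compA -fmap_comp η_r mmult_unitr.
Qed.

Hypothesis dense_closed : factorizes (Tdense M T) (Tclosed M T).

Lemma completion_exists (A : B) : exists (D : B) (r : hom A D), completion T r.
Proof.
have [D [r [i [dr [ci e]]]]] := dense_closed (munit T A).
by exists D, r; apply: dense_closed_completion e.
Qed.

(** Every completion, whether or not it comes from a factorization, is
    isomorphic to the one obtained by factoring the unit, and the dense and the
    closed morphisms are stable under that isomorphism. *)
Lemma completion_dense_closed (A D : B) (r : hom A D) (i : hom D (T A)) :
  completion T r -> i ∘ r = munit T A -> Tdense M T r /\ Tclosed M T i.
Proof.
move=> cr ir; have [D' [r' [i' [dr' [[di' Mi'] e]]]]] := dense_closed (munit T A).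
have cr' : completion T r' by apply: dense_closed_completion e.
split.
  have [j [j_iso <-]] := completion_unique cr' cr.
  exact: vup_iso_compl.
have [j [j_iso jr]] := completion_unique cr cr'.
have -> : i = i' ∘ j.
  by apply: (completion_ext cr (Tcomplete_free A)); rewrite ir -compA jr.
have [[EM _] _] := EM_fs.
split; first exact: vdown_iso_compr.
by apply/EM; apply: vdown_iso_compr => //; apply/EM.
Qed.

End DenseClosed.

(** * The monad of a family of universal arrows *)

Section MonadOfUniversalArrows.
Context {V : symmetric_monoidal_closed} {B : vcat V}.
Variables (D : B -> B) (r : forall A : B, hom A (D A)).
(* Universality is enriched: extension along [r A] is invertible on
   hom-objects.  Hence two maps into a hom-object out of [D A] agree once they
   agree after [pre (r A)], and this is how every law of the monad is proved. *)
Hypothesis r_univ : forall A A' : B, is_iso (pre (r A) (D A')).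

Let ext (A A' : B) : hom (vhom B A (D A')) (vhom B (D A) (D A')) :=
  sval (choose_inverse (r_univ A A')).

Let pre_ext A A' : pre (r A) (D A') ∘ ext A A' = idm _.
Proof. exact: proj2 (svalP (choose_inverse (r_univ A A'))). Qed.

Let r_mono A A' : mono (pre (r A) (D A')).
Proof. exact: is_iso_mono. Qed.

Let act (A1 A2 : B) : hom (vhom B A1 A2) (vhom B (D A1) (D A2)) :=
  ext A1 A2 ∘ post A1 (r A2).

Let pre_act A1 A2 : pre (r A1) (D A2) ∘ act A1 A2 = post A1 (r A2).
Proof. by rewrite /act compA pre_ext comp1m. Qed.

Let act_id A : act A A ∘ vid B A = vid B (D A).
Proof.
apply: r_mono; rewrite compA pre_act.
rewrite (postE (r A) (idm A)) (preE (r A) (idm (D A))).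
by rewrite compm1 comp1m.
Qed.

Let act_comp A1 A2 A3 :
  act A1 A3 ∘ vcomp B A1 A2 A3
  = vcomp B (D A1) (D A2) (D A3) ∘ (act A2 A3 ⊗m act A1 A2).
Proof.
apply: r_mono; rewrite (compA (pre _ _)) pre_act post_vcomp.
rewrite (compA (pre _ _)) pre_vcomp (tensorm_split' (act A2 A3)) -[RHS]compA.
rewrite (compA (idm _ ⊗m pre _ _)) -tensormr pre_act compA -vcomp_pre_post.
by rewrite -compA -tensorml pre_act.
Qed.

Let S : vfunctor B B := VFunctor act_id act_comp.

Let unit_natural A1 A2 :
  post A1 (r A2) ∘ fhom (vfid B) A1 A2 = pre (r A1) (S A2) ∘ fhom S A1 A2.
Proof. by rewrite compm1 pre_act. Qed.

Let S_r (A1 A2 : B) (f : hom A1 A2) : fmap S f ∘ r A1 = r A2 ∘ f.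
Proof. by rewrite -preE /fmap compA pre_act postE. Qed.

Let mult (A : B) : hom (S (S A)) (S A) :=
  (ext (D A) A ∘ (idm (D A) : hom munitob (vhom B (D A) (D A)))).

Let mult_r A : mult A ∘ r (D A) = idm (D A).
Proof. by rewrite -preE /mult compA pre_ext comp1m. Qed.

Let mult_natural A1 A2 :
  post (S (S A1)) (mult A2) ∘ fhom (vfcomp S S) A1 A2
  = pre (mult A1) (S A2) ∘ fhom S A1 A2.
Proof.
apply: r_mono; rewrite /= [LHS]compA -pre_post -[LHS]compA.
rewrite (compA (pre _ _)) pre_act (compA (post _ _)) -post_comp mult_r post_id.
by rewrite (compA (pre _ _)) -pre_comp mult_r pre_id.
Qed.

Definition universal_monad : vmonad B.
Proof.
refine (@VMonad V B S (@VNat V B B (vfid B) S r unit_natural)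
          (@VNat V B B (vfcomp S S) S mult mult_natural) _ _ _) => A.
- exact: mult_r.
- apply: (pre_mono_cancel (@r_mono A A)).
  by rewrite -(compA (mult A)) (S_r (r A)) compA mult_r comp1m.
- apply: (pre_mono_cancel (@r_mono (D (D A)) A)).
  rewrite -!(compA (mult A)) mult_r compm1 (S_r (mult A)).
  by rewrite compA mult_r comp1m.
Defined.

End MonadOfUniversalArrows.

(** * Equality of monads *)

Section MonadExtensionality.
Context {V : symmetric_monoidal_closed} {B : vcat V}.

Lemma vnat_ext (C D : vcat V) (F G : vfunctor C D) (a b : vnat F G) :
  (forall A, a A = b A) -> a = b.
Proof.
case: a b => a na [b nb] /= ab.
have e : a = b by apply: functional_extensionality_dep.
by subst b; rewrite (proof_irrelevance _ na nb).
Qed.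

(** The object map [o] is shared, so that the components of the two monads have
    the same types and no transport is needed; [vmonad_eta] brings an arbitrary
    monad into this form. *)
Lemma vmonad_ext (o : B -> B)
    (h h' : forall A1 A2 : B, hom (vhom B A1 A2) (vhom B (o A1) (o A2)))
    hid hid' hcomp hcomp'
    (F := @VFunctor V B B o h hid hcomp)
    (F' := @VFunctor V B B o h' hid' hcomp')
    (u : vnat (vfid B) F) (u' : vnat (vfid B) F')
    (m : vnat (vfcomp F F) F) (m' : vnat (vfcomp F' F') F')
    l l' r r' a a' :
  (forall A1 A2, h A1 A2 = h' A1 A2) -> (forall A, u A = u' A) ->
  (forall A, m A = m' A) ->
  @VMonad V B F u m l r a = @VMonad V B F' u' m' l' r' a'.
Proof.
move=> hh'; have {hh'} e : h = h'.
  by do 2 apply: functional_extensionality_dep => ?; apply: hh'.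
subst h'; rewrite /F' in u' m' l' r' a' *.
move: u' m' l' r' a'.
rewrite (proof_irrelevance _ hid' hid) (proof_irrelevance _ hcomp' hcomp).
move=> u' m' l' r' a' /vnat_ext uu' /vnat_ext mm'; subst u' m'.
by congr VMonad; apply: proof_irrelevance.
Qed.

Lemma vmonad_eta (S : vmonad B) :
  exists hid hcomp u m l r a,
    S = @VMonad V B (@VFunctor V B B S (fhom S) hid hcomp) u m l r a
    /\ (forall A, u A = munit S A) /\ (forall A, m A = mmult S A).
Proof. by case: S => -[o h hid hcomp] u m l r a; do 7 eexists. Qed.

End MonadExtensionality.

(** * Idempotent cores *)

Section Cores.
Context {V : symmetric_monoidal_closed} {B : vcat V}.

(** The inverses of invertible components are natural in the enriched sense,
    because [pre (a A1)] can be cancelled. *)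
Lemma vnat_iso (F G : vfunctor B B) (a : vnat F G) :
  (forall A, is_iso (a A)) -> is_vnat_iso a.
Proof.
move=> a_iso; pose b A := sval (choose_inverse (a_iso A)).
have ba A : b A ∘ a A = idm _ := proj1 (svalP (choose_inverse (a_iso A))).
have ab A : a A ∘ b A = idm _ := proj2 (svalP (choose_inverse (a_iso A))).
have b_nat A1 A2 : post (G A1) (b A2) ∘ fhom G A1 A2
    = pre (b A1) (F A2) ∘ fhom F A1 A2.
  apply: (is_iso_mono (pre_iso _ (a_iso A1))).
  rewrite compA -pre_post -compA -vnatural compA -post_comp ba post_id comp1m.
  by rewrite compA -pre_comp ba pre_id comp1m.
by exists (VNat b_nat).
Qed.

(** Idempotency: the unit at a complete object is inverted by [T] and has
    complete ends.  The arrows inverted by [S] and by [T] agree because the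
    unit, a completion, turns into an isomorphism under [T], and between
    complete objects an arrow is invertible as soon as [T] inverts it. *)
Lemma core_of_completions (T : vmonad B) :
  (forall A : B, exists (D : B) (r : hom A D), completion T r) ->
  exists S : vmonad B, idempotent_core T S.
Proof.
move=> compl.
have compl' (A : B) : exists p : {D : B & hom A D}, completion T (projT2 p).
  by have [D [r cr]] := compl A; exists (existT _ D r).
pose p A := constructive_indefinite_description _ (compl' A).
pose D A := projT1 (sval (p A)); pose r A : hom A (D A) := projT2 (sval (p A)).
have cr A : completion T (r A) := svalP (p A).
have cD A : Tcomplete T (D A) := proj2 (cr A).
have r_univ (A A' : B) : is_iso (pre (r A) (D A')).
  by apply: (cD A'); apply: (proj1 (cr A)).
pose S := universal_monad r_univ.
have r_D_iso A : is_iso (r (D A)).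
  by apply: (sigma_complete_iso (cD _) (cD _)); apply: (proj1 (cr _)).
exists S; split.
  apply: vnat_iso => A; apply: (is_iso_cancelr (r_D_iso A)).
  by rewrite (mmult_unitl S A); apply: is_iso_id.
move=> A1 A2 f.
have sq : fmap T (fmap S f) ∘ fmap T (r A1) = fmap T (r A2) ∘ fmap T f.
  by rewrite -!fmap_comp -(munit_natural S f).
have [Tr1 Tr2] := (proj1 (cr A1), proj1 (cr A2)).
split=> [Sf | Tf].
  apply: (is_iso_cancell Tr2); rewrite -sq.
  by apply: is_iso_comp => //; apply: fmap_iso.
apply: (sigma_complete_iso (cD A1) (cD A2)).
by apply: (is_iso_cancelr Tr1); rewrite sq; apply: is_iso_comp.
Qed.

Variables (T S : vmonad B).
Hypothesis TS : idempotent_core T S.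

Lemma core_mult_iso (A : B) : is_iso (mmult S A).
Proof. by have [[b inv] _] := TS; exists (b A); apply: inv. Qed.

(** Completeness depends only on the class of arrows inverted. *)
Lemma Tcomplete_core (A : B) : Tcomplete S A <-> Tcomplete T A.
Proof. by have [_ sig] := TS; split=> cA A1 A2 h /sig; apply: cA. Qed.

(** [S A] is complete for [S], being free; and [S] inverts its own unit because
    the invertible multiplication retracts [S η]. *)
Lemma core_unit_completion (A : B) : completion T (munit S A).
Proof.
split; last by apply/Tcomplete_core; apply: Tcomplete_free.
apply/(proj2 TS); apply: (is_iso_cancell (core_mult_iso A)).
by rewrite mmult_unitr; apply: is_iso_id.
Qed.

Lemma core_reflective (A : B) : reflective_of S A <-> Tcomplete T A.
Proof.
split=> [[a [aη _]] | cA].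
  by apply/Tcomplete_core; apply: retract_complete aη.
have [Tη cS] := core_unit_completion A.
exact: sigma_complete_iso Tη.
Qed.

Let lift_unit (A : B) :
  {i : hom (S A) (T A) | i ∘ munit S A = munit T A}.
Proof.
apply: constructive_indefinite_description; apply: pre_iso_extend.
by apply: Tcomplete_free; case: (core_unit_completion A).
Qed.

(** The component at [A] is the unique extension of the unit of [T] along the
    unit of [S]; naturality and compatibility with multiplications hold because
    they hold after restriction along the unit of [S]. *)
Lemma core_morphism_exists : inhabited (vmonad_mor S T).
Proof.
pose i A := sval (lift_unit A).
have i_unit A : i A ∘ munit S A = munit T A := svalP (lift_unit A).
have i_nat A1 A2 : post (S A1) (i A2) ∘ fhom S A1 A2
    = pre (i A1) (T A2) ∘ fhom T A1 A2.
  have /is_iso_mono : is_iso (pre (munit S A1) (T A2)).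
    by apply: Tcomplete_free; case: (core_unit_completion A1).
  apply; rewrite [LHS]compA [RHS]compA -pre_comp i_unit -pre_post -[LHS]compA.
  rewrite -(vnatural (munit T)) -(vnatural (munit S)) [LHS]compA -post_comp.
  by rewrite i_unit.
split; apply: (@VMonadMor V B S T (VNat i_nat)) => A /=; first exact: i_unit.
apply: (completion_ext (core_unit_completion (S A)) (Tcomplete_free A)).
rewrite -[LHS]compA mmult_unitl compm1 -[RHS]compA i_unit -[RHS]compA.
by rewrite -munit_natural compA mmult_unitl comp1m.
Qed.

Lemma core_morphism_unique (iota iota' : vmonad_mor S T) (A : B) :
  iota A = iota' A.
Proof.
apply: (completion_ext (core_unit_completion A) (Tcomplete_free A)).
by rewrite !mor_unit.
Qed.

Let core_complete (A : B) : Tcomplete T (S A).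
Proof. exact: proj2 (core_unit_completion A). Qed.

Let K : vfunctor B (full_sub (Tcomplete T)) := corestrict core_complete.

Let J : vfunctor (full_sub (Tcomplete T)) B := incl (Tcomplete T).

Let unit_inverse (X : full_sub (Tcomplete T)) :
  {c : hom (S (proj1_sig X)) (proj1_sig X) |
    c ∘ munit S (proj1_sig X) = idm _ /\ munit S (proj1_sig X) ∘ c = idm _}.
Proof. by apply/choose_inverse/core_reflective; apply: proj2_sig. Qed.

Let counit (X : full_sub (Tcomplete T)) : hom (K (J X)) X :=
  sval (unit_inverse X).

Let counit_unit X :
  (counit X : hom (S (proj1_sig X)) (proj1_sig X)) ∘ munit S (proj1_sig X)
  = idm (proj1_sig X).
Proof. exact: proj1 (svalP (unit_inverse X)). Qed.

(** This identity makes the adjunction induce [S] with its own multiplication.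
    Both sides are inverse to the unit at [S A]. *)
Let counit_free (A : B) : counit (K A) = mmult S A :> hom (S (S A)) (S A).
Proof.
apply: (completion_ext (core_unit_completion (S A)) (core_complete A)).
by rewrite (counit_unit (K A)) mmult_unitl.
Qed.

Let unit_natural A1 A2 :
  post A1 (munit S A2) ∘ fhom (vfid B) A1 A2
  = pre (munit S A1) (S A2) ∘ fhom (vfcomp J K) A1 A2.
Proof. by rewrite (vnatural (munit S)) /= comp1m. Qed.

Let counit_natural X1 X2 :
  post (K (J X1)) (counit X2) ∘ fhom (vfcomp K J) X1 X2
  = pre (counit X1) X2 ∘ fhom (vfid (full_sub (Tcomplete T))) X1 X2.
Proof.
rewrite /= !compm1.
have /is_iso_mono : is_iso (pre (munit S (proj1_sig X1)) (proj1_sig X2)).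
  by apply: (proj2_sig X2); case: (core_unit_completion (proj1_sig X1)).
apply; rewrite [LHS]compA -pre_post -[LHS]compA -(vnatural (munit S)) compm1.
rewrite -post_comp (counit_unit X2) post_id.
by rewrite -[RHS](@pre_comp V B) (counit_unit X1) pre_id.
Qed.

Definition core_adjunction : vadjunction K J.
Proof.
refine (@VAdjunction V B (full_sub (Tcomplete T)) K J
   (@VNat V B B (vfid B) (vfcomp J K) (munit S) unit_natural)
   (@VNat V _ _ (vfcomp K J) (vfid _) counit counit_natural) _ _).
- by move=> A; rewrite /= -[RHS](mmult_unitr S A) -counit_free.
- by move=> X; rewrite {1}/fmap /= comp1m; apply: counit_unit.
Defined.

Lemma core_adjunction_induces : induces core_adjunction S.
Proof.
have [hid [hcomp [u [m [l [r [a [eS [uE mE]]]]]]]]] := vmonad_eta S.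
rewrite /induces [RHS]eS; apply: vmonad_ext => [A1 A2 | A | A] /=.
- exact: comp1m.
- by rewrite uE.
- by rewrite mE -counit_free [LHS]comp1m.
Qed.

Definition core_reflection : vreflection (Tcomplete T) :=
  VReflection (@Tcomplete_replete V B T) core_adjunction.

End Cores.

(** * Adjunctions inducing the monad *)

Section InducingAdjunctions.
Context {V : symmetric_monoidal_closed} {B C : vcat V}.
Variables (T : vmonad B) (F : vfunctor B C) (G : vfunctor C B).
Variable a : vadjunction F G.
Hypothesis aT : induces a T.

Lemma right_adjoint_complete (X : C) : Tcomplete T (G X).
Proof.
rewrite -aT; apply: (@retract_complete _ _ (induced_monad a) _
                       (fmap G (acounit a X))).
exact: triangle_r.
Qed.

Lemma left_adjoint_sigma (A1 A2 : B) (f : hom A1 A2) :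
  is_iso (fmap F f) -> sigma T f.
Proof. by rewrite -aT /sigma /= fmap_vfcomp; apply: fmap_iso. Qed.

Lemma induced_left_conservative (r : vreflection (Tcomplete T)) :
  conservative (induced_left a r).
Proof.
move=> A1 A2 f; rewrite /induced_left fmap_vfcomp => Ff.
have := left_adjoint_sigma Ff; rewrite /fmap /= comp1m => Tf.
exact: (@sigma_complete_iso _ _ T _ _ f (proj2_sig A1) (proj2_sig A2)).
Qed.

End InducingAdjunctions.

(** * Existence and properties of the idempotent core *)

Theorem theorem6p25 (V : symmetric_monoidal_closed) (B : vcat V)
    (T : vmonad B) (E M : morphisms B)
    (EM_fs : vfactorization_system E M) (EM_proper : vproper E M)
    (dense_closed : factorizes (Tdense M T) (Tclosed M T)) :
  (exists S : vmonad B, idempotent_core T S) /\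
  forall S : vmonad B, idempotent_core T S ->
    (forall A : B, reflective_of S A <-> Tcomplete T A) /\
    (forall A : B, Tcomplete T A -> Tseparated M T A) /\
    (exists iota : vmonad_mor S T,
       (forall (iota' : vmonad_mor S T) (A : B), iota' A = iota A) /\
       forall A : B, Tclosed M T (iota A)) /\
    (forall A : B, Tdense M T (munit S A)) /\
    exists r : vreflection (Tcomplete T),
      induces (refl_adj r) S /\
      forall (C : vcat V) (F : vfunctor B C) (G : vfunctor C B)
          (a : vadjunction F G),
        induces a T ->
        factors_through a r /\
        conservative (induced_left a r).
Proof.
have compl A := completion_exists EM_fs EM_proper dense_closed A.
have dense_closed_at := completion_dense_closed EM_fs EM_proper dense_closed.
split; first exact: core_of_completions compl.
move=> S TS.
have [iota] := core_morphism_exists TS.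
have iota_unit A := mor_unit iota A.
split; first exact: core_reflective.
split.
  move=> A cA; have idA : completion T (idm A).
    by split=> //; rewrite /sigma fmap_id; apply: is_iso_id.
  by case: (dense_closed_at _ _ _ (munit T A) idA (compm1 _)) => _ [].
split.
  exists iota; split=> [iota' A | A]; first exact: core_morphism_unique TS _ _ A.
  by case: (dense_closed_at _ _ _ _ (core_unit_completion TS A) (iota_unit A)).
split.
  move=> A.
  by case: (dense_closed_at _ _ _ _ (core_unit_completion TS A) (iota_unit A)).
exists (core_reflection TS); split; first exact: core_adjunction_induces.
move=> C F G a aT; split; first exact: right_adjoint_complete aT.
exact: induced_left_conservative aT _.
Qed.
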